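(* Let $n\ge 1$ be axial, i.e. such that there is at least one self-conjugate partition of $n$, and let $I:V(G_n)\to\mathbb R$ be any vertex invariant (any real-valued function on the vertices of the partition graph $G_n$). Then $$\rho_I^{\mathrm{sp}}(n)\le\rho_I^{\mathrm{ax}}(n)\le\rho_I^{\mathrm{sp}}(n)+1.$$ If $I$ is conjugation-invariant, i.e. $I(\lambda)=I(\lambda')$ for all $\lambda\in V(G_n)$, then $\operatorname{Argmax}(I)$ is conjugation-invariant (closed under $\lambda\mapsto\lambda'$). If, in addition, $|\operatorname{Argmax}(I)|$ is odd, then $\operatorname{Argmax}(I)\cap\mathrm{Ax}_n\ne\varnothing$.
   Context: Partition graph: $G_n$ is the simple graph whose vertices are the partitions of $n$, written $\lambda=(\lambda_1\ge\dots\ge\lambda_\ell\ge1)$. Two distinct partitions $\lambda,\mu$ of $n$ are adjacent if $\mu$ is obtained from $\lambda$ by an elementary transfer: decrease one part of $\lambda$ by $1$, increase a different part by $1$ (the receiving part may be a newly adjoined zero part), delete a zero part if necessary, and reorder into nonincreasing form. $N_{G_n}(\alpha)$ is the set of neighbors of $\alpha$, $d_{G_n}$ is graph distance, and $d_{G_n}(\lambda,S)=\min_{\alpha\in S}d_{G_n}(\lambda,\alpha)$. $\lambda'$ is the conjugate partition of $\lambda$. Axis and central regions: $\mathrm{Ax}_n=\{\lambda\vdash n:\lambda=\lambda'\}$; $n$ is axial if $\mathrm{Ax}_n\ne\varnothing$; $C_n^{(r)}=\{\lambda\in V(G_n): d_{G_n}(\lambda,\mathrm{Ax}_n)\le r\}$.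 Thin and thick spine: the axial interaction graph $\mathcal A_n$ has vertex set $\mathrm{Ax}_n$, with distinct $\alpha,\beta$ adjacent iff $M(\alpha,\beta):=N_{G_n}(\alpha)\cap N_{G_n}(\beta)\ne\varnothing$. The thin spine is $\mathrm{Sp}_n=\mathrm{Ax}_n\cup\bigcup_{\{\alpha,\beta\}\in E(\mathcal A_n)}M(\alpha,\beta)$, and $\mathrm{Sp}_n^{(r)}=\{\lambda\in V(G_n): d_{G_n}(\lambda,\mathrm{Sp}_n)\le r\}$. Concentration radii: $\operatorname{Argmax}(I)=\{\lambda\in V(G_n): I(\lambda)=\max_{\mu\in V(G_n)}I(\mu)\}$; $\rho_I^{\mathrm{ax}}(n)=\min\{r\ge0:\operatorname{Argmax}(I)\subseteq C_n^{(r)}\}$ and $\rho_I^{\mathrm{sp}}(n)=\min\{r\ge0:\operatorname{Argmax}(I)\subseteq \mathrm{Sp}_n^{(r)}\}$, with $r$ ranging over nonnegative integers. *)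

(* Defs.v *)
From HB Require Import structures.
From mathcomp Require Import all_boot all_order.
From mathcomp Require Import zify.
From mathcomp Require Import reals.

Set Implicit Arguments.
Unset Strict Implicit.
Unset Printing Implicit Defensive.

Import Order.TTheory.

Definition is_intpart (n : nat) (s : seq nat) : bool :=
  [&& sorted geq s, all (ltn 0) s & sumn s == n].

Record intpart (n : nat) := Intpart {
  parts :> seq nat;
  partsP : is_intpart n parts
}.

HB.instance Definition _ n := [isSub for @parts n].
HB.instance Definition _ n := [Choice of intpart n by <:].
HB.instance Definition _ n := [Countable of intpart n by <:].

Lemma leq_size_sumn s : all (ltn 0) s -> size s <= sumn s.
Proof. by elim: s => //= x s IHs /andP[x_gt0 /IHs]; lia. Qed.

Lemma mem_leq_sumn s x : x \in s -> x <= sumn s.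
Proof. by elim: s => //= y s IHs; rewrite inE => /predU1P[->|/IHs]; lia. Qed.

Section IntpartFinite.
Variable n : nat.

Lemma intpart_size_subproof (la : intpart n) :
  size (map (@inord n) la) <= n.
Proof.
rewrite size_map; case/and3P: (partsP la) => _ la_gt0 /eqP sum_la.
by rewrite -[X in _ <= X]sum_la leq_size_sumn.
Qed.

Definition bseq_of_intpart (la : intpart n) : n.-bseq 'I_n.+1 :=
  Bseq (intpart_size_subproof la).

Definition intpart_of_bseq (b : n.-bseq 'I_n.+1) : option (intpart n) :=
  insub (map val b).

Lemma bseq_of_intpartK : pcancel bseq_of_intpart intpart_of_bseq.
Proof.
move=> la; rewrite /intpart_of_bseq /= -map_comp map_id_in ?valK// => x x_la /=.
case/and3P: (partsP la) => _ _ /eqP sum_la.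
by rewrite inordK// ltnS -[X in _ <= X]sum_la mem_leq_sumn.
Qed.

End IntpartFinite.

HB.instance Definition _ n : isFinite (intpart n) :=
  PCanIsFinite (@bseq_of_intpartK n).

(* The [j]-th part (from 0) of the conjugate is #{i | s_i > j}, and it is
   positive exactly when [j] is less than the largest part. *)
Definition conj_seq (s : seq nat) : seq nat :=
  mkseq (fun j => count (ltn j) s) (head 0 s).

Lemma sumn_conj_bound m s : all (geq m) s ->
  \sum_(0 <= j < m) count (ltn j) s = sumn s.
Proof.
elim: s => [|x s IHs] /=; first by rewrite big1_eq.
case/andP=> le_xm /IHs <-; rewrite big_split /=; congr addn.
rewrite (big_cat_nat _ (n := x)) //= big_nat_cond.
rewrite (eq_bigr (fun=> 1)) => [|i]; last by rewrite andbT /= => ->.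
rewrite -big_nat_cond sum_nat_const_nat subn0 muln1 big_nat_cond big1 ?addn0//.
by move=> i /andP[/andP[le_xi _] _]; rewrite ltnNge le_xi.
Qed.

Lemma conj_seqP n s : is_intpart n s -> is_intpart n (conj_seq s).
Proof.
case/and3P=> s_sorted s_gt0 /eqP sum_s; apply/and3P; split.
- rewrite /conj_seq /mkseq sorted_map; apply: (@sub_sorted _ leq); last first.
    exact: iota_sorted.
  by move=> i j le_ij; apply: sub_count => x; apply: leq_ltn_trans.
- rewrite /conj_seq; apply/allP=> x /mapP[j]; rewrite mem_iota add0n /= => lt_j ->.
  by case: s lt_j {s_sorted s_gt0 sum_s} => //= y s ->.
- rewrite /conj_seq sumnE big_map -[X in iota 0 X]subn0 sumn_conj_bound ?sum_s//.
  case: s s_sorted {s_gt0 sum_s} => //= x s.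
  by rewrite (path_sortedE (rev_trans leq_trans)) leqnn => /andP[].
Qed.

Definition conj_intpart n (la : intpart n) : intpart n := Intpart (conj_seqP (partsP la)).

(* Unit transfer from position [i] to position [j]; when [j = size s],
   [incr_nth] adjoins a new part, which becomes 1. *)
Definition transfer (s : seq nat) (i j : nat) : seq nat :=
  sort geq [seq x <- incr_nth (set_nth 0 s i (nth 0 s i).-1) j | 0 < x].

(* Undoing a transfer is a transfer, so this relation is symmetric. *)
Definition padj n : rel (intpart n) := fun la mu =>
  (la != mu) &&
  [exists i : 'I_(size la), exists j : 'I_(size la).+1,
     (i != j :> nat) && (parts mu == transfer la i j)].

Definition nbrs n (al : intpart n) : {set intpart n} := [set la | padj al la].

Section Distance.
Variables (T : finType) (e : rel T).

(* The least length of a walk from [x] to [y]; a shortest walk has fewer than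
   [#|T|] edges, and the value is [#|T|] when there is no walk, which does not
   happen in the (connected) partition graph. *)
Definition gdist (x y : T) : nat :=
  find (fun k => [exists p : k.-tuple T, path e x p && (last x p == y)])
       (iota 0 #|T|).

(* The seed [#|T|] is an upper bound of [gdist], so that this is the minimum
   for nonempty [S]. *)
Definition set_gdist (x : T) (S : {set T}) : nat :=
  \big[minn/#|T|]_(y in S) gdist x y.

Definition gball (S : {set T}) (r : nat) : {set T} :=
  [set x | set_gdist x S <= r].

Lemma ex_sub_gball (A S : {set T}) : exists r, A \subset gball S r.
Proof.
exists #|T|; apply/subsetP=> x _; rewrite inE /set_gdist.
elim/big_rec: _ => // y m _ le_m; exact: leq_trans (geq_minr _ _) le_m.
Qed.

End Distance.

Definition Ax n : {set intpart n} := [set la | la == conj_intpart la].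

Definition axial n : Prop := Ax n != set0.

Definition Mcommon n (al be : intpart n) : {set intpart n} := nbrs al :&: nbrs be.

Definition axial_adj n (al be : intpart n) : bool :=
  [&& al \in Ax n, be \in Ax n, al != be & Mcommon al be != set0].

Definition Sp n : {set intpart n} :=
  Ax n :|: \bigcup_(ab : intpart n * intpart n | axial_adj ab.1 ab.2)
             Mcommon ab.1 ab.2.

Definition central_region n (r : nat) : {set intpart n} := gball (@padj n) (Ax n) r.

Definition thick_spine n (r : nat) : {set intpart n} := gball (@padj n) (Sp n) r.

Section Radii.
Variables (R : realType) (n : nat) (I : intpart n -> R).

(* The seed [I la] is itself one of the values, so this is the maximum of [I]. *)
Definition Argmax : {set intpart n} :=
  [set la | I la == \big[Order.max/I la]_(mu : intpart n) I mu].

Lemma ex_central : exists r, Argmax \subset central_region n r.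
Proof. exact: ex_sub_gball. Qed.

Lemma ex_spine : exists r, Argmax \subset thick_spine n r.
Proof. exact: ex_sub_gball. Qed.

Definition rho_ax : nat := ex_minn ex_central.

Definition rho_sp : nat := ex_minn ex_spine.

End Radii.

(* Main.v *)
Require Import Defs.
From mathcomp Require Import all_boot all_order reals.
From mathcomp Require Import zify.

Set Implicit Arguments.
Unset Strict Implicit.

(** Up to reordering and zero parts, an elementary transfer replaces a
    multiset [a + 1, b, r] by [a, b + 1, r]; in this form adjacency is visibly
    symmetric. Hence every vertex of the thin spine has a neighbor on the axis,
    so balls of radius [r] around the spine lie in balls of radius [r + 1]
    around the axis, while the axis is contained in the spine. The last claim
    holds because a fixed-point-free involution forces even cardinality. *)

(** * Elementary transfers as moves on multisets *)

Lemma perm_nth2 (s : seq nat) m i j : size s <= m -> i < m -> j < m -> i != j ->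
  perm_eq [seq x <- s | 0 < x]
    [seq x <- [:: nth 0 s i, nth 0 s j &
       [seq nth 0 s k | k <- iota 0 m & (k != i) && (k != j)]] | 0 < x].
Proof.
move=> le_sm lt_im lt_jm neq_ij.
(* Padding with zeros up to length [m] is invisible to the filter, so a position past the end of [s]
   stands for a zero part. *)
have ->: [seq x <- s | 0 < x] = [seq x <- mkseq (nth 0 s) m | 0 < x].
  rewrite -(subnKC le_sm) /mkseq iotaD map_cat filter_cat -/(mkseq _ _) mkseq_nth.
  rewrite (_ : [seq x <- [seq nth 0 s k | k <- _] | _] = [::]) ?cats0//.
  apply/eqP; rewrite -size_eq0 size_filter -leqn0 leqNgt -has_count.
  apply/hasPn => x /mapP[k]; rewrite mem_iota add0n => /andP[le_sk _] ->.
  by rewrite nth_default.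
apply: perm_filter; rewrite -!map_cons; apply: perm_map.
apply: uniq_perm; first exact: iota_uniq.
  by rewrite /= !inE !mem_filter !eqxx (negPf neq_ij) /= andbF filter_uniq ?iota_uniq.
move=> k; rewrite !inE mem_filter !mem_iota.
by case: (eqVneq k i) => [->|_] /=; [lia | case: (eqVneq k j) => [->|_] /=; lia].
Qed.

(** The filter covers the boundary cases: [b = 0] adjoins a new part, [a = 0] deletes an exhausted
    one. Exchanging [a] and [b] reverses the move. *)
Definition unit_transfer (x y : seq nat) : Prop :=
  exists a b r, perm_eq x [seq z <- [:: a.+1, b & r] | 0 < z]
             /\ perm_eq y [seq z <- [:: a, b.+1 & r] | 0 < z].

Lemma unit_transfer_sym x y : unit_transfer x y -> unit_transfer y x.
Proof.
case=> a [b [r [xE yE]]]; exists b, a, r; split.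
  by rewrite (perm_trans yE)// perm_filter// (perm_catCA [:: a] [:: b.+1]).
by rewrite (perm_trans xE)// perm_filter// (perm_catCA [:: a.+1] [:: b]).
Qed.

Lemma perm_transfer (s : seq nat) i j : all (ltn 0) s ->
  i < size s -> j <= size s -> i != j ->
  exists r, perm_eq s [seq z <- [:: nth 0 s i, nth 0 s j & r] | 0 < z]
    /\ perm_eq (transfer s i j)
         [seq z <- [:: (nth 0 s i).-1, (nth 0 s j).+1 & r] | 0 < z].
Proof.
move=> s_gt0 lt_i le_j neq_ij.
(* The positions untouched by the transfer; the range has one extra index to leave room for
   [j = size s]. *)
exists [seq nth 0 s k | k <- iota 0 (size s).+1 & (k != i) && (k != j)]; split.
  by rewrite -{1}(all_filterP s_gt0) perm_nth2// ltnW.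
rewrite /transfer perm_sort.
have sz : size (incr_nth (set_nth 0 s i (nth 0 s i).-1) j) <= (size s).+1.
  by rewrite size_incr_nth size_set_nth; case: ifP; lia.
rewrite (permPl (perm_nth2 sz (ltnW lt_i) le_j neq_ij)).
move: (iota _ _) => ks; apply/permP=> p; congr count; congr filter.
rewrite !nth_incr_nth !nth_set_nth /= !eqxx [j == i]eq_sym (negPf neq_ij) /= add0n.
congr [:: _, _ & _]; apply/eq_in_map => k; rewrite mem_filter => /andP[/andP[ki kj] _].
by rewrite nth_incr_nth nth_set_nth /= eq_sym (negPf kj) (negPf ki).
Qed.

(** For the forward direction, the values [a.+1] and [b] are located at positions of [s] followed by
    one zero; sortedness then determines [t] from its multiset. *)
Lemma unit_transferP (s t : seq nat) :
  all (ltn 0) s -> sorted geq t ->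
  unit_transfer s t <->
  exists i j, [/\ i < size s, j <= size s, i != j & t = transfer s i j].
Proof.
move=> s_gt0 t_sorted; split; last first.
  case=> i [j [lt_i le_j neq_ij ->]].
  have [r [sE tE]] := perm_transfer s_gt0 lt_i le_j neq_ij.
  exists (nth 0 s i).-1, (nth 0 s j), r; split=> //.
  by rewrite prednK//; apply: (allP s_gt0); rewrite mem_nth.
case=> a [b [r [sE tE]]].
(* The appended zero plays the role of [b] when [b = 0], and otherwise joins the remaining
   entries. *)
have [r' s'E] : exists r', perm_eq (rcons s 0) [:: a.+1, b & r'].
  case: b sE {tE} => [|b] sE.
    exists [seq z <- r | 0 < z]; rewrite perm_rcons perm_sym.
    by rewrite (perm_catCA [:: a.+1] [:: 0]) /= perm_cons perm_sym.
  exists (0 :: [seq z <- r | 0 < z]); rewrite perm_rcons perm_sym.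
  by rewrite (perm_catCA [:: a.+1; b.+1] [:: 0]) /= perm_cons perm_sym.
rewrite perm_sym in s'E.
have [Is IsP] := perm_iotaP 0 s'E.
case: Is IsP => [|i [|j Is]]// IsP [aE bE _].
have neq_ij : i != j.
  move: (perm_uniq IsP); rewrite iota_uniq /= inE negb_or.
  by case/andP=> /andP[].
have mem_Is k : k \in [:: i, j & Is] -> k <= size s.
  by rewrite (perm_mem IsP) mem_iota size_rcons.
have nth_pad k : nth 0 (rcons s 0) k = nth 0 s k.
  rewrite nth_rcons; case: ltnP => [//|le_sk].
  by rewrite nth_default// if_same.
rewrite nth_pad in aE; rewrite nth_pad in bE.
have le_j : j <= size s by apply: mem_Is; rewrite !inE eqxx orbT.
(* The donor cannot be the appended zero, since its value is [a.+1]. *)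
have lt_i : i < size s.
  by rewrite ltnNge; apply/negP => /(nth_default 0); rewrite -aE.
exists i, j; split=> //.
have [q [sE' tE']] := perm_transfer s_gt0 lt_i le_j neq_ij.
rewrite -aE -bE in sE' tE'.
(* Both lists complete the same two entries to [s], so they can differ only in order and zeros. *)
have qr : perm_eq [seq z <- r | 0 < z] [seq z <- q | 0 < z].
  move: sE'; rewrite (permPl sE) (filter_cat _ [:: a.+1; b] r).
  by rewrite (filter_cat _ [:: a.+1; b] q) perm_cat2l.
apply: (@sorted_eq _ geq) => //.
- by move=> x y z; rewrite /geq /= => xy yz; apply: leq_trans yz xy.
- by move=> x y; rewrite /geq /= => /anti_leq.
- by apply: sort_sorted => x y; rewrite /geq /= leq_total.
rewrite (permPl tE) (permPr tE') (filter_cat _ [:: a; b.+1] r).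
by rewrite (filter_cat _ [:: a; b.+1] q) perm_cat2l.
Qed.

Lemma padjP n (la mu : intpart n) :
  reflect (la != mu /\ unit_transfer la mu) (padj la mu).
Proof.
have /and3P[_ la_gt0 _] := partsP la; have /and3P[mu_sorted _ _] := partsP mu.
apply: (iffP andP) => -[neq]; [move=> /existsP[i /existsP[j /andP[ij /eqP E]]] | ];
  rewrite unit_transferP//; last move=> [i [j [lt_i le_j ij E]]].
  by split=> //; exists i, j; split=> //; rewrite -ltnS.
split=> //; apply/existsP; exists (Ordinal lt_i); apply/existsP.
by exists (Ordinal (le_j : j < (size la).+1)); rewrite /= ij E eqxx.
Qed.

Lemma padj_sym n : symmetric (@padj n).
Proof.
by move=> la mu; apply/padjP/padjP => -[neq /unit_transfer_sym];
  rewrite eq_sym.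
Qed.

(** * Distances and balls in a finite graph *)

Section Distance.
Variables (T : finType) (e : rel T).

Lemma gdist_le_card x y : gdist e x y <= #|T|.
Proof. by rewrite /gdist -[X in _ <= X](size_iota 0) find_size. Qed.

Lemma gdist_le_path x (p : seq T) : path e x p -> gdist e x (last x p) <= size p.
Proof.
move=> xp; have [lt_p|] := ltnP (size p) #|T|; last exact/leq_trans/gdist_le_card.
rewrite leqNgt; apply/negP => /(before_find 0); rewrite nth_iota// add0n.
by move/existsP; apply; exists (in_tuple p); rewrite /= xp eqxx.
Qed.

Lemma gdist_path x y : gdist e x y < #|T| ->
  exists p, [/\ path e x p, last x p = y & size p = gdist e x y].
Proof.
move=> lt_d; have: has (fun k => [exists p : k.-tuple T,
    path e x p && (last x p == y)]) (iota 0 #|T|).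
  by rewrite has_find size_iota.
move/(nth_find 0); rewrite -/(gdist e x y) nth_iota// add0n.
case/existsP=> p /andP[xp /eqP yE]; exists p; split=> //; exact: size_tuple.
Qed.

(** A shortest walk to [y] is prolonged by the edge to [z]; if there is none, the distance to [y] is
    already the cap [#|T|]. *)
Lemma gdist_step x y z : e y z -> gdist e x z <= (gdist e x y).+1.
Proof.
move=> yz; have [/gdist_path[p [xp yE <-]]|le_d] := ltnP (gdist e x y) #|T|.
  have := @gdist_le_path x (rcons p z).
  by rewrite rcons_path xp yE yz last_rcons size_rcons; apply.
by rewrite ltnW// ltnS (leq_trans (gdist_le_card _ _)).
Qed.

(** The first alternative comes from the seed of the minimum, and is the only one left when [S] is
    empty. *)
Lemma set_gdist_leP x (S : {set T}) r :
  reflect (#|T| <= r \/ exists2 y, y \in S & gdist e x y <= r)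
          (set_gdist e x S <= r).
Proof.
apply: (iffP idP); rewrite /set_gdist.
  elim/big_rec: _ => [|y m Sy IHm]; first by left.
  by rewrite geq_min => /orP[le_r|/IHm//]; right; exists y.
case=> [le_r|[y Sy le_r]].
  by elim/big_rec: _ => // y m _ le_m; rewrite geq_min le_m orbT.
have: y \in index_enum T by rewrite mem_index_enum.
elim: (index_enum T) => // z t IHt; rewrite inE big_cons.
case/predU1P=> [<-|/IHt le_t]; first by rewrite Sy geq_min le_r.
by case: ifP => // _; rewrite geq_min le_t orbT.
Qed.

Lemma gballS (A B : {set T}) r : A \subset B -> gball e A r \subset gball e B r.
Proof.
move=> /subsetP sAB; apply/subsetP=> x; rewrite !inE.
case/set_gdist_leP=> [le_r|[y /sAB By le_r]]; apply/set_gdist_leP; first by left.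
by right; exists y.
Qed.

Lemma gball_succ (A B : {set T}) r :
  (forall y, y \in B -> y \in A \/ exists2 z, z \in A & e y z) ->
  gball e B r \subset gball e A r.+1.
Proof.
move=> nearA; apply/subsetP=> x; rewrite !inE.
case/set_gdist_leP=> [le_r|[y By le_r]]; apply/set_gdist_leP.
  by left; exact: leqW.
right; case: (nearA y By) => [Ay|[z Az yz]]; first by exists y => //; exact: leqW.
by exists z => //; rewrite (leq_trans (gdist_step x yz)).
Qed.

End Distance.

Lemma Ax_sub_Sp n : Ax n \subset Sp n.
Proof. exact: subsetUl. Qed.

(** Off the axis, a spine vertex is a common neighbor of two axial vertices; symmetry of [padj]
    orients the edge as [gball_succ] expects. *)
Lemma Sp_near_Ax n (la : intpart n) : la \in Sp n ->
  la \in Ax n \/ exists2 al, al \in Ax n & padj la al.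
Proof.
rewrite inE => /orP[->|]; first by left.
case/bigcupP=> -[al be] /= /and4P[Ax_al _ _ _].
by rewrite !inE => /andP[adj _]; right; exists al; rewrite // padj_sym.
Qed.

(** * Conjugation as an involution *)

Section ConjSeq.
Variable s : seq nat.
Hypothesis s_sorted : sorted geq s.

Lemma leq_head_nth i : nth 0 s i <= head 0 s.
Proof.
have [lt_i|] := ltnP i (size s); last by move/(nth_default 0)->.
case: s s_sorted lt_i => // x t /=.
rewrite (path_sortedE (rev_trans leq_trans)) => /andP[/allP le_x _].
by case: i => //= i lt_i; apply: le_x; rewrite mem_nth.
Qed.

(** Both sides say that the box in row [i] and column [j] lies in the Young diagram: as [s] is
    nonincreasing, the rows reaching column [j] come first. *)
Lemma ltn_count i j : (i < count (ltn j) s) = (j < nth 0 s i).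
Proof.
elim: s s_sorted i => [|x t IHt] /=; first by move=> _ i; rewrite nth_nil.
rewrite (path_sortedE (rev_trans leq_trans)) => /andP[/allP le_x t_sorted] i.
have [lt_jx|le_xj] := ltnP j x; first by case: i => //= i; rewrite -IHt.
have c0 : count (ltn j) t = 0.
  apply/eqP; rewrite -leqn0 leqNgt -has_count; apply/hasPn => y /le_x.
  by rewrite /= -leqNgt => /leq_trans; apply.
rewrite c0 ltn0; case: i => [|i] /=; first by rewrite ltnNge le_xj.
by rewrite -IHt// c0.
Qed.

Lemma conj_seqK : all (ltn 0) s -> conj_seq (conj_seq s) = s.
Proof.
move=> s_gt0.
(* Positivity of the parts enters here: every row meets the first column. *)
have head_conj : head 0 (conj_seq s) = size s.
  move: s_gt0; rewrite /conj_seq; case: s => //= x t /andP[x_gt0 t_gt0].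
  case: x x_gt0 => //= x _; rewrite add1n; congr _.+1.
  by apply/eqP; rewrite -all_count.
apply: (@eq_from_nth _ 0); first by rewrite /conj_seq size_mkseq head_conj.
move=> i; rewrite {1}/conj_seq size_mkseq head_conj => lt_i.
rewrite {1}/conj_seq head_conj nth_mkseq// /conj_seq count_map.
rewrite (eq_count (a2 := fun j => j < nth 0 s i)) => [|j /=]; last exact: ltn_count.
(* The columns are cut at [nth 0 s i]: all those before the cut are counted, none after it. *)
rewrite -(subnKC (leq_head_nth i)) iotaD count_cat add0n.
rewrite (eq_in_count (a2 := predT)) => [|j]; last by rewrite mem_iota => /andP[].
rewrite count_predT size_iota (eq_in_count (a2 := pred0)) => [|j].
  by rewrite count_pred0 addn0.
by rewrite mem_iota => /andP[le_j _]; rewrite ltnNge le_j.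
Qed.

End ConjSeq.

Lemma conj_intpartK n : involutive (@conj_intpart n).
Proof.
move=> la; apply: val_inj => /=.
by have /and3P[] := partsP la => *; apply: conj_seqK.
Qed.

(** Induction on the cardinality: removing a pair [x], [f x] of distinct points keeps both the
    parity and the closure under [f]. *)
Lemma involutive_odd_fixed (T : finType) (f : T -> T) (A : {set T}) :
  involutive f -> (forall x, x \in A -> f x \in A) -> odd #|A| ->
  exists2 x, x \in A & f x = x.
Proof.
move=> fK; have [m] := ubnP #|A|; elim: m A => // m IHm A le_A fA odd_A.
have [A0|[x Ax]] := set_0Vmem A; first by rewrite A0 cards0 in odd_A.
have [fx|fx] := eqVneq (f x) x; first by exists x.
have fx_A1 : f x \in A :\ x by rewrite !inE fx fA.
have cardA := cardsD1 x A; rewrite Ax (cardsD1 (f x) (A :\ x)) fx_A1 in cardA.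
case: (IHm ((A :\ x) :\ f x)) => [|y||y].
- lia.
- rewrite !inE => /and3P[y_fx y_x /fA ->]; rewrite andbT.
  by rewrite (inj_eq (can_inj fK)) y_x (can2_eq fK fK) y_fx.
- by move: odd_A; rewrite cardA !add1n /= negbK.
by rewrite !inE => /and3P[_ _ Ay] fy; exists y.
Qed.

Theorem theorem5p2 (R : realType) (n : nat) (n_ge1 : 1 <= n)
    (n_axial : axial n) (I : intpart n -> R) :
  rho_sp I <= rho_ax I <= rho_sp I + 1
  /\ ((forall la : intpart n, I la = I (conj_intpart la)) ->
        (forall la : intpart n, la \in Argmax I -> conj_intpart la \in Argmax I)
        /\ (odd #|Argmax I| -> Argmax I :&: Ax n != set0)).
Proof.
split.
  rewrite /rho_sp /rho_ax.
  (* By minimality, each bound only requires that the optimal radius for one region, increased by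
     one in the second case, be admissible for the other. *)
  case: ex_minnP => rs sub_sp min_sp; case: ex_minnP => ra sub_ax min_ax.
  apply/andP; split; [apply: min_sp | rewrite addn1; apply: min_ax].
    exact: subset_trans sub_ax (gballS _ _ (Ax_sub_Sp n)).
  exact: subset_trans sub_sp (gball_succ _ (@Sp_near_Ax n)).
move=> Iconj.
have ArgmaxC la : la \in Argmax I -> conj_intpart la \in Argmax I.
  (* The seed of the maximum is also a value of [I] at the vertex, so invariance rewrites both
     sides. *)
  by rewrite !inE -Iconj.
split=> // odd_A.
have [la A_la fixed] := involutive_odd_fixed (@conj_intpartK n) ArgmaxC odd_A.
by apply/set0Pn; exists la; rewrite !inE fixed eqxx andbT; rewrite inE in A_la.
Qed.
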